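(* Let $(X,d)$ be a complete metric space and $\phi:X\to(-\infty,\infty]$ a lower semi-continuous function with $D(\phi)\neq\emptyset$ such that, with respect to a family $\Gamma$ of minimal geodesics and for some $\lambda,K\in\mathbb{R}$, $\phi$ is $\lambda$-convex, the squared distance function is $K$-convex, the commutativity holds, and $\phi$ is coercive (conditions (a)-(d) of the context). Let $\mathcal{G}$ be the gradient flow operator of $\phi$. Take $x_0\in D(\phi)$ and put $\xi(t):=\mathcal{G}(t,x_0)$. Then $$\limsup_{\varepsilon\downarrow0}\frac{d^2(\xi(t+\varepsilon),y)-d^2(\xi(t),y)}{2\varepsilon}+\frac{\lambda}{2}d^2\big(\xi(t),y\big)+\phi\big(\xi(t)\big)\le\phi(y)$$ for all $y\in D(\phi)$ and all $t>0$. In particular, $$\frac12\frac{d}{dt}\big[d^2\big(\xi(t),y\big)\big]+\frac{\lambda}{2}d^2\big(\xi(t),y\big)+\phi\big(\xi(t)\big)\le\phi(y)$$ for all $y\in D(\phi)$ and almost all $t>0$.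
   Context: Setting. A minimal geodesic is a curve $\gamma:[0,1]\to X$ with $d(\gamma(s),\gamma(t))=|s-t|\,d(\gamma(0),\gamma(1))$ for all $s,t\in[0,1]$. $D(\phi):=X\setminus\phi^{-1}(\infty)$. $\lambda$ and $K$ may be negative. $\Gamma$ is a family of minimal geodesics in $X$ containing, for every $x,y\in X$, at least one minimal geodesic from $x$ to $y$, such that: (a) ($\lambda$-convexity of $\phi$) for every $\gamma\in\Gamma$ with $\gamma(0),\gamma(1)\in D(\phi)$ and every $t\in[0,1]$, $\phi(\gamma(t))\le(1-t)\phi(\gamma(0))+t\phi(\gamma(1))-\frac{\lambda}{2}(1-t)t\,d^2(\gamma(0),\gamma(1))$; (b) ($K$-convexity of the squared distance) for every $z\in X$, $\gamma\in\Gamma$, $t\in[0,1]$, $d^2(z,\gamma(t))\le(1-t)d^2(z,\gamma(0))+t\,d^2(z,\gamma(1))-\frac{K}{2}(1-t)t\,d^2(\gamma(0),\gamma(1))$; (c) (commutativity) for all $\gamma,\eta\in\Gamma$ with $\gamma(0)=\eta(0)=x$, $\gamma(1)=y$, $\eta(1)=z$, the following limits exist and agree: $\lim_{s\downarrow 0}\frac{d^2(\gamma(s),z)-d^2(x,z)}{s}=\lim_{t\downarrow 0}\frac{d^2(\eta(t),y)-d^2(x,y)}{t}$; (d) (coercivity) there is $\tau_*(\phi)\in(0,\infty]$ such that for all $x\in X$ and $\tau\in(0,\tau_*(\phi))$, $\phi_\tau(x):=\inf_{z\in X}\{\phi(z)+\frac{d^2(x,z)}{2\tau}\}>-\infty$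 and $J^\phi_\tau(x):=\{z\in X: \phi(z)+\frac{d^2(x,z)}{2\tau}=\phi_\tau(x)\}\neq\emptyset$. This setting includes the case where $(X,d)$ is a complete $\mathrm{CAT}(1)$-space with $\operatorname{diam}X<\pi/2$ and $\phi$ is lower semi-continuous and $\lambda$-convex along minimal geodesics ($\Gamma$ being all minimal geodesics; then (b) for some $K>0$, (c) and (d) hold). Discrete solutions. A partition is $\mathscr{P}_{\boldsymbol{\tau}}=\{0=t^0_{\boldsymbol{\tau}}<t^1_{\boldsymbol{\tau}}<\cdots\}$ with $t^k_{\boldsymbol{\tau}}\to\infty$; $\tau_k:=t^k_{\boldsymbol{\tau}}-t^{k-1}_{\boldsymbol{\tau}}$, $|\boldsymbol{\tau}|:=\sup_{k\ge1}\tau_k$ (always assumed $<\tau_*(\phi)$). A discrete solution from $x_0\in D(\phi)$ associated with $\mathscr{P}_{\boldsymbol{\tau}}$ is a sequence with $x^0_{\boldsymbol{\tau}}=x_0$ and $x^k_{\boldsymbol{\tau}}\in J^\phi_{\tau_k}(x^{k-1}_{\boldsymbol{\tau}})$ for $k\ge1$. Its interpolated curve is $\bar{x}_{\boldsymbol{\tau}}(0):=x_0$, $\bar{x}_{\boldsymbol{\tau}}(t):=x^k_{\boldsymbol{\tau}}$ for $t\in(t^{k-1}_{\boldsymbol{\tau}},t^k_{\boldsymbol{\tau}}]$. Gradient flow. In this setting, for each $x_0\in D(\phi)$ the interpolated curves $\bar{x}_{\boldsymbol{\tau}}$ converge, as $|\boldsymbol{\tau}|\to0$, uniformly on bounded intervals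 to a curve $\xi:[0,\infty)\to D(\phi)$ with $\xi(0)=x_0$ which is independent of the choices of partitions and discrete solutions; one defines $\mathcal{G}:[0,\infty)\times D(\phi)\to D(\phi)$ by $\mathcal{G}(t,x_0):=\xi(t)$. *)

(* Defs.v *)
From HB Require Import structures.
From mathcomp Require Import all_boot all_order all_algebra.
From mathcomp Require Import all_classical all_reals all_analysis.

Set Implicit Arguments.
Unset Strict Implicit.
Unset Printing Implicit Defensive.

Import Order.TTheory GRing.Theory Num.Theory.
Import numFieldNormedType.Exports.

Local Open Scope classical_set_scope.
Local Open Scope ring_scope.

(* The base point required by [Complete] is harmless here: the spaces
   considered below are nonempty. *)
#[short(type="completeMetricType")]
HB.structure Definition CompleteMetric (R : numDomainType) :=
  {T of Metric R T & Complete T}.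

Section gradient_flow.
Context {R : realType} {X : metricType R}.
(* Curves on [0, 1] or [0, +oo) are total functions on R; only their values
   on the relevant interval are ever constrained or used. *)
Implicit Types (phi : X -> \bar R) (Gamma : set (R -> X)) (gamma eta : R -> X).
Implicit Types (x y z : X) (lambda K tau : R) (tau_star : \bar R).

Definition sqdist x y : R := mdist x y ^+ 2.

Definition effective_domain phi : set X := [set x | phi x != +oo%E].

Definition minimal_geodesic gamma : Prop :=
  forall s t, 0 <= s <= 1 -> 0 <= t <= 1 ->
    mdist (gamma s) (gamma t) = `|s - t| * mdist (gamma 0) (gamma 1).

Definition geodesic_family Gamma : Prop :=
  (forall gamma, Gamma gamma -> minimal_geodesic gamma) /\
  (forall x y, exists gamma, [/\ Gamma gamma, gamma 0 = x & gamma 1 = y]).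

Definition convex_along Gamma lambda phi : Prop :=
  forall gamma, Gamma gamma ->
    effective_domain phi (gamma 0%R) -> effective_domain phi (gamma 1%R) ->
  forall t, 0 <= t <= 1 ->
    (phi (gamma t) <=
       (1 - t)%:E * phi (gamma 0%R) + t%:E * phi (gamma 1%R)
       - (lambda / 2 * (1 - t) * t * sqdist (gamma 0) (gamma 1))%:E)%E.

Definition sqdist_convex_along Gamma K : Prop :=
  forall z gamma, Gamma gamma -> forall t, 0 <= t <= 1 ->
    sqdist z (gamma t) <=
      (1 - t) * sqdist z (gamma 0) + t * sqdist z (gamma 1)
      - K / 2 * (1 - t) * t * sqdist (gamma 0) (gamma 1).

Definition commutativity Gamma : Prop :=
  forall gamma eta x y z, Gamma gamma -> Gamma eta ->
    gamma 0 = x -> eta 0 = x -> gamma 1 = y -> eta 1 = z ->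
  exists l : R,
    (sqdist (gamma s) z - sqdist x z) / s @[s --> 0^'+] --> l /\
    (sqdist (eta t) y - sqdist x y) / t @[t --> 0^'+] --> l.

Definition penalized phi tau x z : \bar R :=
  (phi z + (sqdist x z / (2 * tau))%:E)%E.

Definition moreau_yosida phi tau x : \bar R :=
  ereal_inf (range (penalized phi tau x)).

Definition resolvent phi tau x : set X :=
  [set z | penalized phi tau x z = moreau_yosida phi tau x].

Definition coercive phi tau_star : Prop :=
  (0 < tau_star)%E /\
  forall x tau, 0 < tau -> (tau%:E < tau_star)%E ->
    (-oo < moreau_yosida phi tau x)%E /\ resolvent phi tau x !=set0.

Definition time_partition (p : nat -> R) : Prop :=
  [/\ p 0%N = 0, forall k, p k < p k.+1 & p @ \oo --> +oo].

Definition mesh (p : nat -> R) : \bar R :=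
  ereal_sup (range (fun k => (p k.+1 - p k)%:E)).

Definition discrete_solution phi (p : nat -> R) x0 (u : nat -> X) : Prop :=
  u 0%N = x0 /\ forall k, resolvent phi (p k.+1 - p k) (u k) (u k.+1).

(* Determines [ubar] uniquely on [0, +oo) when [p] is a partition. *)
Definition interpolated_curve (p : nat -> R) (u : nat -> X) (ubar : R -> X)
    : Prop :=
  ubar 0 = u 0%N /\ forall k t, p k < t <= p k.+1 -> ubar t = u k.+1.

(* Uniform convergence on bounded intervals as the mesh tends to 0, over all
   partitions, discrete solutions and interpolations simultaneously. *)
Definition discrete_solutions_cvg phi tau_star x0 (xi : R -> X) : Prop :=
  forall T e : R, 0 < e -> exists2 delta : R, 0 < delta &
    forall p u ubar, time_partition p ->
      (mesh p < tau_star)%E -> (mesh p < delta%:E)%E ->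
      discrete_solution phi p x0 u -> interpolated_curve p u ubar ->
    forall t, 0 <= t <= T -> mdist (ubar t) (xi t) < e.

(* [G] is characterized by this predicate on [0, +oo) x D(phi): coercivity
   provides discrete solutions for arbitrarily fine partitions, so that the
   limit curve is unique. *)
Definition gradient_flow_operator phi tau_star (G : R -> X -> X) : Prop :=
  forall x0, effective_domain phi x0 ->
    [/\ G 0 x0 = x0,
        forall t, 0 <= t -> effective_domain phi (G t x0) &
        discrete_solutions_cvg phi tau_star x0 (G ^~ x0)].

End gradient_flow.

(* Main.v *)
From HB Require Import structures.
Require Import Defs.
From mathcomp Require Import all_boot all_order all_algebra.
From mathcomp Require Import all_classical all_reals all_analysis.
From mathcomp Require Import ring lra.

Import Order.TTheory GRing.Theory Num.Theory.
Import numFieldNormedType.Exports.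

Local Open Scope classical_set_scope.
Local Open Scope ring_scope.

(* Comparing a minimizer z of phi + d^2(x, .) / (2 h) with the points of a
   geodesic from z to y, and letting commutativity exchange the roles of x
   and y before K-convexity is applied, gives a discrete evolution variational
   inequality for one step. Summed along a uniform grid, its K-term telescopes
   and is of order h; since phi decreases along discrete solutions, lower
   semicontinuity at the end point alone suffices to let h -> 0 and obtain an
   integrated inequality for xi between any two times. The pointwise
   inequality follows by lower semicontinuity and right-continuity.

   For the differentiability of f t := d^2(xi t, y), the integrated inequality
   shows that f t - c t is nonincreasing, and, with y := xi s, that
   d^2(xi s, xi t) <= 2 (t - s) (P t - P s) with P t := C t - phi (xi t), a
   nondecreasing right-continuous function. By AM-GM the increments of c t - f t
   are at most C_e (t - s) + e (P t - P s) for every e > 0, so that its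
   Stieltjes measure is absolutely continuous; Radon-Nikodym and Lebesgue's
   differentiation theorem conclude. *)

(** * Stieltjes measures dominated by Lebesgue measure *)

Section lincomb_cumulative.
Context {R : realType} (a b : {nonneg R}) (F P : cumulative R R).

Definition lincomb : R -> R := fun x => a%:num * F x + b%:num * P x.

Let lincomb_nd : nondecreasing lincomb.
Proof.
move=> x y xy; rewrite /lincomb lerD// ler_wpM2l//;
  exact: cumulative_is_nondecreasing.
Qed.

Let lincomb_rc : right_continuous lincomb.
Proof.
by move=> x; apply: cvgD; apply: cvgMl_tmp;
  exact: cumulative_is_right_continuous.
Qed.

HB.instance Definition _ := isCumulative.Build R _ R lincomb
  lincomb_nd lincomb_rc.

Lemma lebesgue_stieltjes_ocitv (H : cumulative R R) (s t : R) :
  lebesgue_stieltjes_measure H `]s, t]%classic =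
    (if s < t then H t - H s else 0)%:E.
Proof.
rewrite /lebesgue_stieltjes_measure /measure_extension measurable_mu_extE//=;
  last exact: is_ocitv.
by rewrite wlength_itv/= lte_fin; case: ifP.
Qed.

(** Both sides are measures in [A]; they agree on the half-open intervals []s, t]], and these
    determine a Stieltjes measure. *)
Lemma lebesgue_stieltjes_lincomb (A : set (measurableTypeR R)) : measurable A ->
  (lebesgue_stieltjes_measure lincomb A =
     a%:num%:E * lebesgue_stieltjes_measure F A +
     b%:num%:E * lebesgue_stieltjes_measure P A)%E.
Proof.
move=> mA.
pose nu := measure_add (mscale a (lebesgue_stieltjes_measure F))
  (mscale b (lebesgue_stieltjes_measure P)).
rewrite -[RHS](measure_addE (mscale a _) (mscale b _) A) -/nu.
apply: (@lebesgue_stieltjes_measure_unique _ lincomb nu) => //.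
move=> _ [[s t] _ <-].
transitivity (a%:num%:E * lebesgue_stieltjes_measure F `]s, t]%classic +
    b%:num%:E * lebesgue_stieltjes_measure P `]s, t]%classic)%E; last first.
  by rewrite [RHS]measure_addE.
rewrite !lebesgue_stieltjes_ocitv.
rewrite -!EFinM -EFinD /lincomb; congr EFin.
case: ifPn => _; last by rewrite !mulr0 addr0.
by rewrite /= !mulrBr opprD addrACA.
Qed.

End lincomb_cumulative.

Section stieltjes_derivable.
Context {R : realType}.
Implicit Types F G P : cumulative R R.
Local Notation mu := (@lebesgue_measure R).

(** The measure is an infimum over countable covers by half-open intervals, and smaller increments
    make every cover cheaper. *)
Lemma le_lebesgue_stieltjes F G (A : set (measurableTypeR R)) :
  (forall s t, s <= t -> F t - F s <= G t - G s) ->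
  (lebesgue_stieltjes_measure F A <= lebesgue_stieltjes_measure G A)%E.
Proof.
move=> FG; apply: le_ereal_inf_tmp => _ [B [mB AB] <-].
apply: le_trans (ereal_inf_lbound _) _; first by exists B.
apply: lee_nneseries => [k _ _|k _ /=]; first exact: wlength_ge0.
have [[s t] _ <-] := mB k.
rewrite !wlength_itv/= lte_fin; case: ifPn => // st.
by rewrite -!EFinB lee_fin FG// ltW.
Qed.

(** On a Lebesgue null set the increment bound leaves only [e] times the [P]-measure, which is at
    most [e * M], with [e] arbitrary. *)
Lemma lebesgue_stieltjes_dominated F P (M : R) :
  (forall s t, P t - P s <= M) ->
  (forall e : R, 0 < e -> exists2 C : R, 0 <= C & forall s t, s <= t ->
     F t - F s <= C * (t - s) + e * (P t - P s)) ->
  lebesgue_stieltjes_measure F `<< mu.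
Proof.
move=> PM FP; apply/null_content_dominatesP => A mA A0.
have PA : (lebesgue_stieltjes_measure P A <= M%:E)%E.
  apply: (@le_trans _ _ (lebesgue_stieltjes_measure P setT)).
    by apply: le_measure; rewrite ?inE.
  (* The line is the increasing union of the intervals []-k, k]], whose [P]-measure is an increment
     of [P], hence at most [M]. *)
  have -> : [set: measurableTypeR R] = \bigcup_k `](- k%:R), k%:R]%classic.
    apply/esym; rewrite -subTset => /= x _ /=.
    exists (Num.bound `|x|) => //=; have := archi_boundP (normr_ge0 x).
    by rewrite ltr_norml in_itv/= => /andP[-> /ltW].
  have cP := @nondecreasing_cvg_mu _ _ _
    (lebesgue_stieltjes_measure P) (fun k : nat => `](- k%:R), k%:R]%classic).
  apply: (cvge_to_le (cP _ _ _)).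
  - by move=> k; exact: measurable_itv.
  - by apply: bigcup_measurable => k _; exact: measurable_itv.
  - move=> m n mn; apply/subsetPset; apply: subset_itv; rewrite bnd_simp.
      by rewrite lerN2 ler_nat.
    by rewrite ler_nat.
  apply: nearW => k /=; rewrite lebesgue_stieltjes_ocitv.
  case: ifPn => _; rewrite lee_fin//.
  by apply: le_trans (PM 0 0); rewrite subrr.
apply/eqP; rewrite eq_le measure_ge0 andbT; apply/lee_addgt0Pr => e e0.
rewrite add0e.
have M0 : 0 <= M by apply: le_trans (PM 0 0); rewrite subrr.
(* The denominator is [M + 1] because [M] may be zero. *)
have e1 : 0 < e / (M + 1) by rewrite divr_gt0// ltr_wpDl.
have [C C0 FC] := FP _ e1.
pose G := lincomb (NngNum C0) (NngNum (ltW e1)) idfun P.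
apply: (@le_trans _ _ (lebesgue_stieltjes_measure G A)).
  apply: le_lebesgue_stieltjes => s t /FC /le_trans; apply.
  by rewrite /G /lincomb/= !mulrBr opprD addrACA.
rewrite lebesgue_stieltjes_lincomb//= [X in (_ * X + _)%E]A0 mule0 add0e.
apply: le_trans (lee_wpmul2l _ PA) _; first by rewrite lee_fin ltW.
rewrite -EFinM lee_fin mulrAC ler_pdivrMr ?ltr_wpDl//.
by rewrite ler_pM2l// lerDl.
Qed.

(** On []a, b]] the measure is finite, so its Radon-Nikodym density is integrable and [F - F a] is
    an indefinite integral there; Lebesgue differentiation applies. *)
Lemma lebesgue_stieltjes_ae_derivable F (a b : R) :
  lebesgue_stieltjes_measure F `<< mu ->
  {ae mu, forall x, a < x < b -> derivable F x 1}.
Proof.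
move=> Fmu.
pose D : set (measurableTypeR R) := `]a, b]%classic.
have mD : measurable D by exact: measurable_itv.
have Doo : (lebesgue_stieltjes_measure F D < +oo)%E.
  by rewrite lebesgue_stieltjes_ocitv; case: ifPn => _; rewrite ltry.
have numu : mfrestr mD Doo `<< mu.
  apply/null_content_dominatesP => A mA A0.
  rewrite /mfrestr /mrestr.
  have /null_content_dominatesP := Fmu; apply.
    exact: measurableI.
  apply/eqP; rewrite eq_le measure_ge0 andbT -A0.
  by apply: le_measure; rewrite ?inE//; exact: measurableI.
have [g [g0 gfin gint gE]] := radon_nikodym_sigma_finite numu.
pose h : R -> R := fine \o g.
have gE' : g = EFin \o h by apply/funext => x /=; rewrite fineK.
rewrite gE' in gint.
have inth (y : R) : mu.-integrable `]-oo, y] (EFin \o h).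
  exact: integrableS gint.
have loch : locally_integrable [set: R] h.
  have -> : h = h \_ setT by apply/funext => x; rewrite patchE in_setT.
  exact: integrable_locally.
have := FTC1Ny inth loch.
apply: filterS; first exact: (ae_filter_ringOfSetsType mu).
move=> x [+ _] /andP[ax xb].
move=> /(@derivableD _ _ _ (cst (F a)) _ _ _ (derivable_cst _ _ _)).
apply: near_eq_derivable.
near=> y.
have ay : a < y by near: y; exact: lt_nbhsr.
have yb : y < b by near: y; exact: lt_nbhsl.
(* The restricted measure ignores everything left of [a], so integrating the density from [-oo]
   yields [F y - F a]. *)
have yE : `]-oo, y] `&` D = `]a, y]%classic.
  apply/seteqP; split => z; rewrite /D /setI /= !in_itv/=.
    by case=> zy /andP[az _]; rewrite az.
  by case/andP => az zy; rewrite az zy (le_trans zy (ltW yb)).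
have : lebesgue_stieltjes_measure F `]a, y]%classic =
    (\int[mu]_(t in `]-oo, y]) (h t)%:E)%E.
  rewrite -yE; have := gE `]-oo, y]%classic (measurable_itv _).
  by rewrite gE'.
rewrite lebesgue_stieltjes_ocitv ay => /esym/(congr1 fine) /= Fy.
transitivity (F a + (F y - F a)); last by rewrite addrC subrK.
by rewrite -Fy.
Unshelve. all: by end_near. Qed.
End stieltjes_derivable.

(** The hypotheses concern [[a, b]], whereas a Stieltjes measure needs a function on the line. [F]
    inherits right continuity from the increment bound, [P] being bounded. *)
Lemma ae_derivable_itv (R : realType) (F P : R -> R) (a b : R) :
  {in `[a, b] &, {homo F : s t / s <= t}} ->
  {in `[a, b] &, {homo P : s t / s <= t}} ->
  (forall s e : R, s \in `[a, b] -> 0 < e -> exists2 d : R, 0 < d &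
     forall t, t \in `[a, b] -> s <= t < s + d -> P t < P s + e) ->
  (forall e : R, 0 < e -> exists2 C : R, 0 <= C &
     {in `[a, b] &, forall s t, s <= t ->
       F t - F s <= C * (t - s) + e * (P t - P s)}) ->
  {ae (@lebesgue_measure R), forall x, a < x < b -> derivable F x 1}.
Proof.
move=> F_nd P_nd P_rc FP.
have [ab|ba] := ltP a b; last first.
  by apply: aeW => x /andP[ax /(lt_trans ax)]; rewrite ltNge ba.
(* [c] is the projection onto [[a, b]]: monotone and 1-Lipschitz, so composing with it preserves the
   hypotheses, and equal to the identity near interior points. *)
pose c (x : R) := Num.max a (Num.min x b).
have cab x : c x \in `[a, b].
  by rewrite in_itv/= le_max lexx/= ge_max (ltW ab) ge_min lexx orbT.
have c_nd x y : x <= y -> c x <= c y.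
  move=> xy; rewrite /c; case: (leP x b); case: (leP y b) => yb xb;
  by rewrite ?ge_max ?le_max; lra.
have c_id x : x \in `[a, b] -> c x = x.
  by rewrite in_itv/= => /andP[ax xb]; rewrite /c min_l// max_r.
have c_le x y : x <= y -> c y - c x <= y - x.
  move=> xy; rewrite /c; case: (leP x b); case: (leP y b) => yb xb;
  by rewrite ?(max_r (ltW ab)); case: (leP a x); case: (leP a y); lra.
have Fc_nd : nondecreasing (F \o c) by move=> x y /c_nd; exact: F_nd.
have Pc_nd : nondecreasing (P \o c) by move=> x y /c_nd; exact: P_nd.
have Pc_rc : right_continuous (P \o c).
  move=> x; apply/cvgrPdist_lt => e e0 /=.
  have [d d0 Pd] := P_rc (c x) e (cab x) e0.
  near=> y.
  have xy : x <= y by near: y; exact: nbhs_right_ge.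
  have := Pc_nd _ _ xy => /= Pxy.
  rewrite distrC ger0_norm ?subr_ge0// ltrBlDl; apply: Pd => //.
  rewrite c_nd//= -ltrBlDl; apply: le_lt_trans (c_le _ _ xy) _.
  rewrite ltrBlDl; near: y; apply: nbhs_right_lt; rewrite ltrDl//.
have PcM s t : P (c t) - P (c s) <= P b - P a.
  have [ain bin] : a \in `[a, b] /\ b \in `[a, b].
    by rewrite !in_itv/= !lexx ltW.
  have := cab s; have := cab t; rewrite !in_itv/= => /andP[_ tb] /andP[sa _].
  by rewrite lerB// P_nd.
have M0 : 0 <= P b - P a by apply: le_trans (PcM a a); rewrite subrr.
have FPc e : 0 < e -> exists2 C : R, 0 <= C & forall s t, s <= t ->
    F (c t) - F (c s) <= C * (t - s) + e * (P (c t) - P (c s)).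
  move=> /FP[C C0 H]; exists C => // s t st.
  apply: le_trans (H _ _ (cab s) (cab t) (c_nd _ _ st)) _.
  by rewrite lerD2r ler_wpM2l// c_le.
have Fc_rc : right_continuous (F \o c).
  move=> x; apply/cvgrPdist_lt => e e0 /=.
  (* With this weight the [P]-term is at most [e / 2]; closeness of [y] to [x] takes care of the
     [C]-term. *)
  have e1 : 0 < e / 2 / (P b - P a + 1) by rewrite !divr_gt0// ltr_wpDl.
  have [C C0 H] := FPc _ e1.
  near=> y.
  have xy : x <= y by near: y; exact: nbhs_right_ge.
  have := Fc_nd _ _ xy => /= Fxy.
  rewrite distrC ger0_norm ?subr_ge0//; apply: le_lt_trans (H _ _ xy) _.
  rewrite [ltRHS]splitr; apply: ltr_leD.
    have : y - x < e / 2 / (C + 1).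
      rewrite ltrBlDl; near: y; apply: nbhs_right_lt.
      by rewrite ltrDl !divr_gt0// ltr_wpDl.
    rewrite ltr_pdivlMr ?ltr_wpDl//; apply: le_lt_trans.
    by rewrite mulrC ler_wpM2l ?subr_ge0// lerDl.
  rewrite mulrAC ler_pdivrMr ?ltr_wpDl// ler_pM2l ?divr_gt0//.
  by rewrite (le_trans (PcM _ _))// lerDl.
pose Fc : cumulative R R :=
  HB.pack (F \o c) (isCumulative.Build R _ R _ Fc_nd Fc_rc).
pose Pc : cumulative R R :=
  HB.pack (P \o c) (isCumulative.Build R _ R _ Pc_nd Pc_rc).
have Fc_ac : lebesgue_stieltjes_measure Fc `<< @lebesgue_measure R.
  exact: (@lebesgue_stieltjes_dominated _ Fc Pc (P b - P a)).
have := lebesgue_stieltjes_ae_derivable Fc a b Fc_ac.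
apply: filterS; first exact: (ae_filter_ringOfSetsType (@lebesgue_measure R)).
move=> x /[swap] /[dup] axb /[swap] /[apply]; apply: near_eq_derivable.
case/andP: axb => ax xb; near=> y.
rewrite /= c_id// in_itv/=; apply/andP; split; apply: ltW; near: y.
  exact: lt_nbhsr.
exact: lt_nbhsl.
Unshelve. all: by end_near. Qed.

(** * Discrete solutions on a uniform grid *)

Section variational.
Context {R : realType} {X : metricType R}.
Implicit Types (x y z : X).

Lemma sqdist_sym x y : sqdist x y = sqdist y x.
Proof. by rewrite /sqdist metric_sym. Qed.

Lemma sqdist_ge0 x y : 0 <= sqdist x y.
Proof. exact: sqr_ge0. Qed.

Lemma sqdistxx x : sqdist x x = 0.
Proof. by rewrite /sqdist mdistxx expr0n. Qed.

(** Once [p] is replaced by [q + r], the two sides differ by a square over a positive number. With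
    elapsed times as weights, squared distance over time is subadditive along a chain. *)
Lemma sqdist_triangle_div x y z (a b : R) : 0 < a -> 0 < b ->
  sqdist x z / (a + b) <= sqdist x y / a + sqdist y z / b.
Proof.
move=> a0 b0; have ab0 : 0 < a + b by rewrite addr_gt0.
have := metric_triangle x y z; rewrite /sqdist.
have := mdist_ge0 x y; have := mdist_ge0 y z; have := mdist_ge0 x z.
move: (mdist x z) (mdist x y) (mdist y z) => p q r p0 r0 q0 pqr.
have p2 : p ^+ 2 <= (q + r) ^+ 2 by rewrite lerXn2r// nnegrE// addr_ge0.
apply: (@le_trans _ _ ((q + r) ^+ 2 / (a + b))).
  by rewrite ler_pM2r// invr_gt0.
rewrite -subr_ge0.
have -> : q ^+ 2 / a + r ^+ 2 / b - (q + r) ^+ 2 / (a + b) =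
    (q * b - r * a) ^+ 2 / (a * b * (a + b)).
  by field; rewrite !gt_eqF.
by rewrite divr_ge0 ?sqr_ge0// !mulr_ge0// ltW.
Qed.

Context (phi : X -> \bar R) (phi_gtNy : forall x, (-oo < phi x)%E).
Local Notation phir := (fine \o phi).
Local Notation dom := (effective_domain phi).

Lemma effective_domain_fine x : dom x -> (phir x)%:E = phi x.
Proof.
move=> dx; rewrite /= fineK// fin_numE dx andbT.
by rewrite gt_eqF.
Qed.

Lemma effective_domain_le x (r : R) : (phi x <= r%:E)%E ->
  dom x /\ phir x <= r.
Proof.
move=> xr; have dx : dom x by apply/eqP => e; move: xr; rewrite e leye_eq.
by split=> //; rewrite -lee_fin effective_domain_fine.
Qed.

Lemma resolvent_min h x z y : resolvent phi h x z -> dom y ->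
  dom z /\ phir z + sqdist x z / (2 * h) <= phir y + sqdist x y / (2 * h).
Proof.
move=> zJ dy.
have : (penalized phi h x z <= penalized phi h x y)%E.
  by rewrite zJ; apply: ereal_inf_lbound; exists y.
rewrite /penalized -(effective_domain_fine _ dy) -EFinD.
rewrite -leeBrDr// -EFinB => /effective_domain_le[dz].
by rewrite lerBrDr.
Qed.

(** Two geodesics leave [z]: [g] towards [y] and [e] towards [x]. Commutativity makes one number [l]
    the initial slope of d^2(., x) along [g] and of d^2(., y) along [e]; it is bounded from both
    sides. *)
Lemma resolvent_variational (Gamma : set (R -> X)) (lambda K h : R) x z y :
  geodesic_family Gamma -> convex_along Gamma lambda phi ->
  sqdist_convex_along Gamma K -> commutativity Gamma ->
  0 < h -> resolvent phi h x z -> dom y ->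
  (sqdist z y - sqdist x y) / 2 +
    h * (lambda / 2 * sqdist z y + phir z - phir y) + K / 4 * sqdist x z <= 0.
Proof.
move=> [_ Gex] phi_cvx d2_cvx comm h0 zJ dy.
have [dz _] := resolvent_min _ _ _ _ zJ dy.
have [g [Gg g0 g1]] := Gex z y.
have [e [Ge e0 e1]] := Gex z x.
have [l [gl el]] := comm g e z y x Gg Ge g0 e0 g1 e1.
have cvg1B (c : R) : c * (1 - t) @[t --> 0^'+] --> c.
  rewrite -[in X in _ --> X](mulr1 c) -[in X in _ --> X](subr0 1).
  apply: cvg_at_right_filter; apply: cvgMl_tmp.
  by apply: cvgB; [exact: cvg_cst|exact: cvg_id].
have unit_itv : \forall t \near (0 : R)^'+, 0 < t /\ t <= 1.
  near=> t; split; near: t; [exact: nbhs_right_gt|exact: nbhs_right_le].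
(* Minimality of [z] against [g t] and lambda-convexity along [g], divided by [t]; the factor
   [1 - t] tends to 1. *)
have l_ge : 2 * h * (phir z - phir y + lambda / 2 * sqdist z y) <= l.
  have lim1 : 2 * h * (phir z - phir y) +
      2 * h * (lambda / 2 * sqdist z y) * (1 - t) @[t --> 0^'+] -->
      2 * h * (phir z - phir y) + 2 * h * (lambda / 2 * sqdist z y).
    by apply: cvgD => //; exact: cvg_cst.
  rewrite mulrDr; apply: ler_cvg_to lim1 gl _.
  near=> t.
  have [t0 t1] : 0 < t /\ t <= 1 by near: t.
  have t01 : 0 <= t <= 1 by rewrite ltW.
  have := phi_cvx g Gg; rewrite g0 g1 => /(_ dz dy t t01).
  rewrite -(effective_domain_fine _ dz) -(effective_domain_fine _ dy).
  rewrite -!EFinM -!EFinD => /effective_domain_le[dg Hg].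
  have [_ +] := resolvent_min _ _ _ _ zJ dg.
  rewrite ler_pdivlMr// (sqdist_sym (g t)) (sqdist_sym z x) => Hm.
  have {}Hm := le_trans Hm (lerD Hg (lexx _)).
  have h20 : 0 < 2 * h by rewrite mulr_gt0.
  rewrite -(ler_pM2l h20) !mulrDr in Hm.
  have hK (u : R) : 2 * h * (u / (2 * h)) = u by rewrite mulrC divfK ?gt_eqF.
  move: Hm; rewrite !hK /=; lra.
(* K-convexity along [e], seen from [y], bounds the quotients of the second limit. *)
have l_le : l <= sqdist x y - sqdist z y - K / 2 * sqdist x z.
  have lim2 : sqdist x y - sqdist z y - K / 2 * sqdist x z * (1 - t)
      @[t --> 0^'+] --> sqdist x y - sqdist z y - K / 2 * sqdist x z.
    by apply: cvgB => //; exact: cvg_cst.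
  apply: ler_cvg_to el lim2 _.
  near=> t.
  have [t0 t1] : 0 < t /\ t <= 1 by near: t.
  have t01 : 0 <= t <= 1 by rewrite ltW.
  have := d2_cvx y e Ge t t01; rewrite e0 e1.
  rewrite ler_pdivrMr// (sqdist_sym y) (sqdist_sym y z) (sqdist_sym y x).
  by rewrite (sqdist_sym z x); lra.
lra.
Unshelve. all: by end_near. Qed.

End variational.

(** * Times and indices on a uniform grid *)

Section uniform_grid.
Context {R : realType}.
Implicit Types (h t : R) (n : nat).

(** For [0 <= t] this is the least [n] with [t <= n%:R * h]: cells are open on the left, as in
    [interpolated_curve], and time 0 has index 0. *)
Definition grid_index h t : nat := `|Num.ceil (t / h)|%N.

Lemma grid_index_le h t n : 0 < h -> 0 <= t ->
  (grid_index h t <= n)%N = (t <= n%:R * h).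
Proof.
move=> h0 t0; rewrite -lez_nat gez0_abs ?ceil_ge0.
  by rewrite ceil_le_int ler_pdivrMr.
by rewrite (lt_le_trans (ltrN10 R))// divr_ge0// ltW.
Qed.

Lemma grid_index_gt h t n : 0 < h -> 0 <= t ->
  (n < grid_index h t)%N = (n%:R * h < t).
Proof. by move=> h0 t0; rewrite ltnNge grid_index_le// ltNge. Qed.

Lemma grid_index_eq h t n : 0 < h -> n%:R * h < t <= n.+1%:R * h ->
  grid_index h t = n.+1.
Proof.
move=> h0 /andP[nt tn].
have t0 : 0 <= t by rewrite (le_trans _ (ltW nt))// mulr_ge0// ltW.
by apply/eqP; rewrite eqn_leq grid_index_le// tn/= grid_index_gt.
Qed.

Lemma grid_index0 h : grid_index h 0 = 0%N.
Proof. by rewrite /grid_index mul0r ceil0 absz0. Qed.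

Lemma le_grid_index h s t : 0 < h -> 0 <= s -> s <= t ->
  (grid_index h s <= grid_index h t)%N.
Proof.
move=> h0 s0 st; have t0 := le_trans s0 st.
by rewrite grid_index_le//; apply: (le_trans st); rewrite -grid_index_le.
Qed.

Lemma grid_index_ge h t : 0 < h -> 0 <= t -> t <= (grid_index h t)%:R * h.
Proof. by move=> h0 t0; rewrite -grid_index_le. Qed.

Lemma grid_index_lt h t : 0 < h -> 0 <= t -> (grid_index h t)%:R * h < t + h.
Proof.
move=> h0 t0; case E : (grid_index h t) => [|n].
  by rewrite mul0r ltr_wpDl.
by rewrite -natr1 mulrDl mul1r ltrD2r -grid_index_gt// E.
Qed.

(** Turns bounds at all times in [[s, t]] into bounds at the grid points visited in between. *)
Lemma grid_index_onto h s t n : 0 < h -> 0 <= s -> s <= t ->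
  (grid_index h s < n <= grid_index h t)%N ->
  exists2 r, s <= r <= t & grid_index h r = n.
Proof.
(* The grid time of the last index may exceed [t], so [t] itself is the witness there. *)
move=> h0 s0 st /andP[sn]; rewrite leq_eqVlt => /predU1P[->|nt].
  by exists t => //; rewrite st lexx.
have t0 := le_trans s0 st.
exists (n%:R * h).
  by rewrite -grid_index_le// ltnW//= ltW// -grid_index_gt.
case: n sn nt => // n sn nt.
by apply: (grid_index_eq h) => //; rewrite lexx andbT ltr_pM2r// ltr_nat.
Qed.

Lemma time_partition_grid h : 0 < h -> time_partition (fun n => n%:R * h).
Proof.
move=> h0; split; first by rewrite mul0r.
  by move=> n; rewrite ltr_pM2r// ltr_nat.
apply/cvgryPge => A; near=> n; rewrite -ler_pdivrMr//.
by near: n; exact: nbhs_infty_ger.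
Unshelve. all: by end_near. Qed.

Lemma grid_step h n : n.+1%:R * h - n%:R * h = h.
Proof. by rewrite -natr1 mulrDl mul1r addrC addKr. Qed.

Lemma mesh_grid h : mesh (fun n => n%:R * h) = h%:E.
Proof.
rewrite /mesh; have -> : (fun n => (n.+1%:R * h - n%:R * h)%:E) = cst h%:E.
  by apply/funext => n; rewrite grid_step.
rewrite (_ : range _ = [set h%:E]) ?ereal_sup1//.
by apply/seteqP; split => [_ [n _ <-]//|_ ->]; exists 0%N.
Qed.

End uniform_grid.

(** * Energy and variational estimates along a discrete solution *)

Section discrete_solution.
Context {R : realType} {X : metricType R}.
Context (phi : X -> \bar R) (phi_gtNy : forall x, (-oo < phi x)%E).
Context (Gamma : set (R -> X)) (lambda K : R).
Context (Gamma_geod : geodesic_family Gamma)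
  (phi_convex : convex_along Gamma lambda phi)
  (d2_convex : sqdist_convex_along Gamma K)
  (Gamma_comm : commutativity Gamma).
Local Notation phir := (fine \o phi).
Local Notation dom := (effective_domain phi).

Context {h : R} {u : nat -> X} (h0 : 0 < h) (u0_dom : dom (u 0%N))
  (u_step : forall n, resolvent phi h (u n) (u n.+1)).
Local Notation a := (fun n => phir (u n)).

Lemma discrete_dom n : dom (u n).
Proof.
elim: n => // n IHn.
by have [] := resolvent_min _ phi_gtNy _ _ _ _ (u_step n) IHn.
Qed.

(** Minimality of [u n.+1] tested against [u n]. *)
Lemma discrete_step n : sqdist (u n) (u n.+1) <= 2 * h * (a n - a n.+1).
Proof.
have [_] := resolvent_min _ phi_gtNy _ _ _ _ (u_step n) (discrete_dom n).
rewrite sqdistxx mul0r addr0 -lerBrDl ler_pdivrMr ?mulr_gt0//.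
by rewrite mulrC.
Qed.

Lemma discrete_nonincr m n : (m <= n)%N -> a n <= a m.
Proof.
elim: n => [|n IHn]; first by rewrite leqn0 => /eqP ->.
rewrite leq_eqVlt => /predU1P[->//|/IHn]; apply: le_trans.
have := le_trans (sqdist_ge0 _ _) (discrete_step n).
by rewrite pmulr_rge0 ?mulr_gt0// subr_ge0.
Qed.

(** Steps are joined by [sqdist_triangle_div] with weights counting them, and the energy drops
    telescope. *)
Lemma discrete_holder m n : (m <= n)%N ->
  sqdist (u m) (u n) <= 2 * ((n - m)%:R * h) * (a m - a n).
Proof.
move=> /subnK <-; move: (n - m)%N => {}n; rewrite addnK.
elim: n => [|n IHn]; first by rewrite add0n sqdistxx mul0r mulr0 mul0r.
have step := discrete_step (n + m).
(* The weighted triangle inequality needs a positive number of earlier steps. *)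
have [n0|n0] := eqVneq n 0%N.
  by move: step; rewrite n0 !add0n add1n mul1r.
have n0' : 0 < n%:R :> R by rewrite ltr0n lt0n.
have := sqdist_triangle_div (u m) (u (n + m)) (u (n + m).+1) _ _ n0' (@ltr01 R).
rewrite divr1 natr1 ler_pdivrMr// addSn => /le_trans; apply.
have : sqdist (u m) (u (n + m)) / n%:R <= 2 * h * (a m - a (n + m)%N).
  rewrite ler_pdivrMr//; apply: le_trans IHn _.
  by rewrite le_eqVlt; apply/orP; left; apply/eqP; ring.
move=> H; rewrite [leRHS](_ : _ = (2 * h * (a m - a (n + m)%N) +
   2 * h * (a (n + m)%N - a (n + m)%N.+1)) * n.+1%:R); last by ring.
by rewrite ler_pM2r// lerD.
Qed.

(** Sum of the one-step inequalities. Each energy is bounded below by the last and smallest one,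
    [a n], and [discrete_step] bounds the K-terms by multiples of energy drops, which telescope. *)
Lemma discrete_evi y (B : R) m n : dom y -> (m <= n)%N ->
  (forall k, (m < k <= n)%N -> B <= lambda / 2 * sqdist (u k) y) ->
  (sqdist (u n) y - sqdist (u m) y) / 2 +
    (n - m)%:R * h * (B + a n - phir y) <= `|K| / 2 * h * (a m - a n).
Proof.
move=> dy mn HB.
suff H k : (m + k <= n)%N -> (sqdist (u (m + k)) y - sqdist (u m) y) / 2 +
    k%:R * h * (B + a n - phir y) <= `|K| / 2 * h * (a m - a (m + k)%N).
  by have := H (n - m)%N; rewrite !subnKC// => /(_ (leqnn n)).
elim: k => [|k IHk]; first by rewrite addn0 !subrr !mul0r mulr0 addr0.
rewrite addnS => mkn.
have := IHk (ltnW mkn).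
have := resolvent_variational _ phi_gtNy _ _ _ _ _ _ y Gamma_geod phi_convex
  d2_convex Gamma_comm h0 (u_step (m + k)) dy.
have step := discrete_step (m + k).
have : - (K / 4 * sqdist (u (m + k)) (u (m + k).+1)) <=
    `|K| / 2 * h * (a (m + k)%N - a (m + k)%N.+1).
  apply: (@le_trans _ _ (`|K| / 4 * sqdist (u (m + k)) (u (m + k).+1))).
    rewrite -mulNr ler_wpM2r ?sqdist_ge0// -mulNr ler_pM2r//.
    by rewrite lerNl lerNnormlW.
  apply: le_trans (ler_wpM2l _ step) _; first by rewrite divr_ge0.
  by rewrite le_eqVlt; apply/orP; left; apply/eqP; field.
have : h * (B + a n - phir y) <= h * (lambda / 2 * sqdist (u (m + k).+1) y +
    a (m + k)%N.+1 - phir y).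
  rewrite ler_pM2l// lerD2r lerD ?HB ?discrete_nonincr//.
  by rewrite mkn andbT ltnS leq_addr.
rewrite -[k.+1%:R]natr1 [(_ + 1) * h]mulrDl mul1r [(_ + h) * _]mulrDl.
move: (a n) (a m) (a (m + k)%N) (a (m + k)%N.+1) => an am amk amk1.
rewrite /=; lra.
Qed.

End discrete_solution.

(** * The limit curve *)

Section metric_limits.
Context {R : realType} {X : metricType R}.

Lemma mdist_lipschitz (x y z w : X) :
  `|mdist x y - mdist z w| <= mdist x z + mdist y w.
Proof.
have := metric_triangle x z y; have := metric_triangle z w y.
have := metric_triangle z x w; have := metric_triangle x y w.
rewrite (metric_sym z x) (metric_sym w y) ler_norml => *.
by apply/andP; split; lra.
Qed.

Lemma sqdist_close (x z y : X) (d D : R) : mdist x z <= d -> mdist z y <= D ->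
  `|sqdist x y - sqdist z y| <= d * (2 * D + d).
Proof.
move=> xz zy; have := mdist_lipschitz x y z y; rewrite mdistxx addr0.
move=> xzy; have {xzy}xzy := le_trans xzy xz.
have d0 : 0 <= d := le_trans (mdist_ge0 _ _) xz.
rewrite /sqdist subr_sqr normrM ler_pM// ger0_norm ?addr_ge0 ?mdist_ge0//.
by move: xzy; rewrite ler_norml => /andP[_]; lra.
Qed.

Lemma cvg_mdist (f g : nat -> X) (x y : X) :
  mdist (f n) x @[n --> \oo] --> (0 : R) ->
  mdist (g n) y @[n --> \oo] --> (0 : R) ->
  mdist (f n) (g n) @[n --> \oo] --> mdist x y.
Proof.
move=> fx gy; apply/cvgrPdist_le => e e0.
have fg : mdist (f n) x + mdist (g n) y @[n --> \oo] --> (0 : R).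
  by rewrite -[in X in _ --> X](addr0 0); apply: cvgD.
near=> n; rewrite distrC; apply: le_trans (mdist_lipschitz _ _ _ _) _.
by near: n; move/cvgr_le : fg; apply.
Unshelve. all: by end_near. Qed.

Lemma cvg_sqdist (f g : nat -> X) (x y : X) :
  mdist (f n) x @[n --> \oo] --> (0 : R) ->
  mdist (g n) y @[n --> \oo] --> (0 : R) ->
  sqdist (f n) (g n) @[n --> \oo] --> sqdist x y.
Proof.
move=> fx gy; rewrite /sqdist expr2; under eq_fun do rewrite expr2.
by apply: cvgM; exact: cvg_mdist.
Qed.

(** Semicontinuity passes only strict lower bounds [A < c] to the approximants; letting [A] increase
    to [c] recovers the inequality at [c]. *)
Lemma ler_affine_lt (x p q c : R) :
  (forall A, A < c -> x + q * A <= p) -> x + q * c <= p.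
Proof.
move=> H; have cvgA : x + q * A @[A --> c^'-] --> x + q * c.
  apply: cvg_at_left_filter; apply: cvgD; first exact: cvg_cst.
  by apply: cvgMl_tmp; exact: cvg_id.
apply: (cvgr_to_le cvgA); near=> A; apply: H; near: A.
exact: nbhs_left_lt.
Unshelve. all: by end_near. Qed.

End metric_limits.

Section limit_curve.
Context {R : realType} {X : metricType R}.
Context {phi : X -> \bar R} (phi_gtNy : forall x, (-oo < phi x)%E)
  (phi_lsc : lower_semicontinuous phi).
Context {Gamma : set (R -> X)} {lambda K : R} {tau_star : \bar R}.
Context (Gamma_geod : geodesic_family Gamma)
  (phi_convex : convex_along Gamma lambda phi)
  (d2_convex : sqdist_convex_along Gamma K)
  (Gamma_comm : commutativity Gamma)
  (phi_coercive : coercive phi tau_star).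
Context {x0 : X} {xi : R -> X} (x0_dom : effective_domain phi x0)
  (xi_dom : forall t, 0 <= t -> effective_domain phi (xi t))
  (xi_cvg : discrete_solutions_cvg phi tau_star x0 xi).
Local Notation phir := (fine \o phi).
Local Notation dom := (effective_domain phi).

Lemma lsc_fine (x : X) (A : R) : dom x -> A < phir x ->
  exists2 d : R, 0 < d & forall z, mdist z x < d -> dom z -> A < phir z.
Proof.
move=> dx Ax; have : (A%:E < phi x)%E.
  by rewrite -(effective_domain_fine _ phi_gtNy)// lte_fin.
move=> /phi_lsc[V /nbhs_ballP[d /= d0 dV] VA]; exists d => // z zx dz.
rewrite -lte_fin (effective_domain_fine _ phi_gtNy)//; apply: VA; apply: dV.
by rewrite ballEmdist /= metric_sym.
Qed.

Lemma small_step_ex (e : R) : 0 < e ->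
  exists2 h : R, 0 < h < e & (h%:E < tau_star)%E.
Proof.
move=> e0; have [ts0 _] := phi_coercive.
case: tau_star ts0 => [r| |]//.
  rewrite lte_fin => r0; exists (Num.min e r / 2).
    rewrite divr_gt0 ?lt_min ?e0//= ltr_pdivrMr// gt_min.
    by apply/orP; left; lra.
  by rewrite lte_fin ltr_pdivrMr// gt_min; apply/orP; right; lra.
by move=> _; exists (e / 2); rewrite ?ltry//; apply/andP; split; lra.
Qed.

Lemma discrete_solution_ex (h : R) : 0 < h -> (h%:E < tau_star)%E ->
  exists2 u : nat -> X, u 0%N = x0 & forall n, resolvent phi h (u n) (u n.+1).
Proof.
move=> h0 hts; have [_ J] := phi_coercive.
have /choice[f fJ] : forall x, exists z, resolvent phi h x z.
  by move=> x; have [_ []] := J x h h0 hts => z; exists z.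
by exists (fun n => iter n f x0).
Qed.

(** The convergence of discrete solutions is used through this single diagonal sequence, close to
    [xi] on intervals growing with [k]. *)
Lemma grid_approx_ex : exists (h : nat -> R) (u : nat -> nat -> X),
  forall k, [/\ 0 < h k, h k < k.+1%:R^-1, u k 0%N = x0,
    forall n, resolvent phi (h k) (u k n) (u k n.+1) &
    forall t, 0 <= t <= k%:R ->
      mdist (u k (grid_index (h k) t)) (xi t) < k.+1%:R^-1].
Proof.
suff /choice[hu huP] : forall k : nat, exists hu : R * (nat -> X),
    [/\ 0 < hu.1, hu.1 < k.+1%:R^-1, hu.2 0%N = x0,
    forall n, resolvent phi hu.1 (hu.2 n) (hu.2 n.+1) &
    forall t, 0 <= t <= k%:R ->
      mdist (hu.2 (grid_index hu.1 t)) (xi t) < k.+1%:R^-1].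
  by exists (fun k => (hu k).1), (fun k => (hu k).2).
move=> k; have k0 : 0 < k.+1%:R^-1 :> R by rewrite invr_gt0.
have [d d0 Hd] := xi_cvg k%:R _ k0.
(* A step below [d] triggers the convergence hypothesis; below [k.+1%:R^-1] it makes the steps tend
   to 0. *)
have [|h /andP[h0 hd] hts] := small_step_ex (Num.min d k.+1%:R^-1).
  by rewrite lt_min d0.
have [u u0 uJ] := discrete_solution_ex h h0 hts.
exists (h, u); move: hd; rewrite lt_min => /andP[hd hk]; split=> //= t t0k.
apply: (Hd (fun n => n%:R * h) u (fun t => u (grid_index h t))) => //.
- exact: time_partition_grid.
- by rewrite mesh_grid.
- by rewrite mesh_grid lte_fin.
- by split=> // n; rewrite grid_step.
- split; first by rewrite grid_index0.
  by move=> n s ns; rewrite (grid_index_eq h s n).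
Qed.

Context {h : nat -> R} {u : nat -> nat -> X}
  (hu : forall k, [/\ 0 < h k, h k < k.+1%:R^-1, u k 0%N = x0,
    forall n, resolvent phi (h k) (u k n) (u k n.+1) &
    forall t, 0 <= t <= k%:R ->
      mdist (u k (grid_index (h k) t)) (xi t) < k.+1%:R^-1]).

Local Notation v := (fun k t => u k (grid_index (h k) t)).

Let h_gt0 k : 0 < h k. Proof. by have [] := hu k. Qed.

Let u0_dom k : dom (u k 0%N). Proof. by have [_ _ ->] := hu k. Qed.

Let u_step k n : resolvent phi (h k) (u k n) (u k n.+1).
Proof. by have [_ _ _] := hu k. Qed.

Lemma cvg_step : h k @[k --> \oo] --> (0 : R).
Proof.
apply: (@squeeze_cvgr _ _ _ _ (cst 0) harmonic); last 2 first.
- exact: cvg_cst.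
- exact: cvg_harmonic.
by apply: nearW => k /=; have [h0 hk _ _ _] := hu k; rewrite !ltW.
Qed.

Lemma cvg_approx t : 0 <= t -> mdist (v k t) (xi t) @[k --> \oo] --> (0 : R).
Proof.
move=> t0; apply: (@squeeze_cvgr _ _ _ _ (cst 0) harmonic); last 2 first.
- exact: cvg_cst.
- exact: cvg_harmonic.
near=> k; rewrite mdist_ge0/=; apply: ltW.
have [_ _ _ _] := hu k; apply; rewrite t0/=.
by near: k; exact: nbhs_infty_ger.
Unshelve. all: by end_near. Qed.

Lemma approx_lsc t A : 0 <= t -> A < phir (xi t) ->
  \forall k \near \oo, A < phir (v k t).
Proof.
move=> t0 At; have [d d0 Hd] := lsc_fine (xi t) A (xi_dom t t0) At.
near=> k; apply: Hd.
  by near: k; move/cvgr_lt : (cvg_approx t t0); apply.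
exact: (discrete_dom _ phi_gtNy (u0_dom k) (u_step k)).
Unshelve. all: by end_near. Qed.

Lemma cvg_grid t : 0 <= t ->
  (grid_index (h k) t)%:R * h k @[k --> \oo] --> t.
Proof.
move=> t0; apply: (@squeeze_cvgr _ _ _ _ (cst t) (fun k => t + h k)).
- apply: nearW => k /=; rewrite grid_index_ge//= ltW//.
  exact: grid_index_lt.
- exact: cvg_cst.
- rewrite -[in X in _ --> X](addr0 t); apply: cvgD; first exact: cvg_cst.
  exact: cvg_step.
Qed.

Lemma cvg_gridB s t : 0 <= s -> s <= t ->
  (grid_index (h k) t - grid_index (h k) s)%:R * h k @[k --> \oo] --> t - s.
Proof.
move=> s0 st; under eq_fun do rewrite natrB ?le_grid_index// mulrBl.
by apply: cvgB; apply: cvg_grid => //; exact: le_trans st.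
Qed.

(** * Estimates inherited by the limit curve *)

Lemma xi_holder s t : 0 <= s -> s <= t ->
  sqdist (xi s) (xi t) <= 2 * (t - s) * (phir x0 - phir (xi t)).
Proof.
move=> s0 st; have t0 := le_trans s0 st.
rewrite mulrBr lerBrDr; apply: ler_affine_lt => A At; rewrite -lerBrDr -mulrBr.
have lim1 := cvg_sqdist _ _ _ _ (cvg_approx s s0) (cvg_approx t t0).
have lim2 : 2 * ((grid_index (h k) t - grid_index (h k) s)%:R * h k) *
    (phir x0 - A) @[k --> \oo] --> 2 * (t - s) * (phir x0 - A).
  by apply: cvgMr_tmp; apply: cvgMl_tmp; exact: cvg_gridB.
apply: ler_cvg_to lim1 lim2 _; near=> k.
have mn := le_grid_index (h k) s t (h_gt0 k) s0 st.
have u0 : u k 0%N = x0 by have [] := hu k.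
apply: le_trans (discrete_holder _ phi_gtNy (h_gt0 k) (u0_dom k) (u_step k)
  _ _ mn) _.
apply: ler_wpM2l.
  by rewrite mulr_ge0// mulr_ge0// ltW.
apply: lerB; last first.
  by apply: ltW; near: k; exact: approx_lsc.
have := discrete_nonincr _ phi_gtNy (h_gt0 k) (u0_dom k) (u_step k) 0%N
  (grid_index (h k) s) (leq0n _).
by rewrite u0.
Unshelve. all: by end_near. Qed.

(** On [[0, T]] the curve stays within distance 1 of one discrete solution, which visits finitely
    many points there; the sum of their distances to [y] bounds each of them. *)
Lemma xi_bounded (T : R) (y : X) :
  exists D : R, forall t, 0 <= t <= T -> mdist (xi t) y <= D.
Proof.
pose k := Num.bound T.
exists (1 + \sum_(i < (grid_index (h k) T).+1) mdist (u k i) y).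
move=> t /andP[t0 tT].
have [_ _ _ _ /(_ t)] := hu k.
have Tk : T <= k%:R by rewrite ltW// archi_boundP// (le_trans t0).
rewrite t0 (le_trans tT)// => /(_ isT) vt.
apply: le_trans (metric_triangle _ (v k t) _) _; rewrite metric_sym.
apply: lerD; first by rewrite (le_trans (ltW vt))// invf_le1// ler1n.
have iT : (grid_index (h k) t < (grid_index (h k) T).+1)%N.
  by rewrite ltnS le_grid_index.
rewrite (bigD1 (Ordinal iT))//= lerDl sumr_ge0// => i _.
exact: mdist_ge0.
Qed.

(** Coercivity at [x0] bounds [phi] below by a constant minus a multiple of d^2(x0, .), which is
    bounded along [xi]. *)
Lemma phi_xi_bounded (T : R) :
  exists m : R, forall t, 0 <= t <= T -> m <= phir (xi t).
Proof.
have [tau /andP[tau0 _] taus] := small_step_ex 1 ltr01.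
have [D xiD] := xi_bounded T x0.
have [_ /(_ x0 tau tau0 taus)[myNy _]] := phi_coercive.
have pen z : (moreau_yosida phi tau x0 <= penalized phi tau x0 z)%E.
  by apply: ereal_inf_lbound; exists z.
have : (moreau_yosida phi tau x0 \is a fin_num).
  rewrite fin_numElt myNy; apply: le_lt_trans (pen x0) _.
  by rewrite /penalized -(effective_domain_fine _ phi_gtNy)// -EFinD ltry.
move=> /fineK myE.
exists (fine (moreau_yosida phi tau x0) - D ^+ 2 / (2 * tau)).
move=> t tT; have t0 : 0 <= t by case/andP: tT.
have := pen (xi t); rewrite /penalized -myE.
rewrite -(effective_domain_fine _ phi_gtNy (xi t) (xi_dom t t0)).
rewrite -EFinD lee_fin.
move=> /le_trans H; rewrite lerBlDr; apply: H; rewrite lerD2l.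
rewrite ler_pM2r ?invr_gt0 ?mulr_gt0// sqdist_sym.
rewrite lerXn2r// ?nnegrE ?mdist_ge0//.
  by rewrite (le_trans (mdist_ge0 _ _) (xiD _ tT)).
exact: xiD.
Qed.

(** Limit of [discrete_evi]. The constant [B] stands for the lambda-term, so that no integral over
    time occurs. *)
Lemma xi_evi s t y (B : R) : 0 <= s -> s <= t -> dom y ->
  (forall r, s <= r <= t -> B <= lambda / 2 * sqdist (xi r) y) ->
  (sqdist (xi t) y - sqdist (xi s) y) / 2 +
    (t - s) * (B + phir (xi t) - phir y) <= 0.
Proof.
move=> s0 st dy HB; have t0 := le_trans s0 st.
have [D xiD] := xi_bounded t y.
have D0 : 0 <= D by apply: le_trans (mdist_ge0 _ _) (xiD t _); rewrite t0 lexx.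
rewrite [leLHS](_ : _ = (sqdist (xi t) y - sqdist (xi s) y) / 2 +
  (t - s) * (phir (xi t) - phir y) + (t - s) * B); last by rewrite /=; ring.
(* Two margins are opened: [B'] below [B] absorbs the distance between [xi] and its approximants,
   and [A] below [phir (xi t)] makes room for lower semicontinuity. *)
apply: ler_affine_lt => B' B'B.
rewrite [leLHS](_ : _ = (sqdist (xi t) y - sqdist (xi s) y) / 2 +
  (t - s) * (B' - phir y) + (t - s) * phir (xi t)); last by rewrite /=; ring.
apply: ler_affine_lt => A At.
rewrite [leLHS](_ : _ = (sqdist (xi t) y - sqdist (xi s) y) / 2 +
  (t - s) * (B' + A - phir y)); last by rewrite /=; ring.
have cvgy : mdist y y @[k --> \oo] --> (0 : R).
  by rewrite mdistxx; exact: cvg_cst.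
have lim1 : (sqdist (v k t) y - sqdist (v k s) y) / 2 +
    (grid_index (h k) t - grid_index (h k) s)%:R * h k * (B' + A - phir y)
    @[k --> \oo] -->
    (sqdist (xi t) y - sqdist (xi s) y) / 2 + (t - s) * (B' + A - phir y).
  apply: cvgD.
    apply: cvgMr_tmp; apply: cvgB; apply: cvg_sqdist => //;
      exact: cvg_approx.
  by apply: cvgMr_tmp; exact: cvg_gridB.
have lim2 : `|K| / 2 * h k * (phir x0 - A) @[k --> \oo] --> (0 : R).
  rewrite -[in X in _ --> X](mul0r (phir x0 - A)).
  rewrite -[in X in _ --> X](mulr0 (`|K| / 2)).
  by apply: cvgMr_tmp; apply: cvgMl_tmp; exact: cvg_step.
apply: ler_cvg_to lim1 lim2 _; near=> k.
have mn := le_grid_index (h k) s t (h_gt0 k) s0 st.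
have u0 : u k 0%N = x0 by have [] := hu k.
have Ak : A <= phir (v k t) by apply: ltW; near: k; exact: approx_lsc.
have tk : t <= k%:R by near: k; exact: nbhs_infty_ger.
have ksmall : `|lambda| / 2 * (k.+1%:R^-1 * (2 * D + k.+1%:R^-1)) <= B - B'.
  near: k.
  have lim3 : `|lambda| / 2 * (k.+1%:R^-1 * (2 * D + k.+1%:R^-1))
      @[k --> \oo] --> (0 : R).
    rewrite -[in X in _ --> X](mulr0 (`|lambda| / 2)).
    rewrite -[in X in _ --> X](mul0r (2 * D + 0)).
    apply: cvgMl_tmp; apply: cvgM; first exact: cvg_harmonic.
    by apply: cvgD; [exact: cvg_cst|exact: cvg_harmonic].
  by move/cvgr_le : lim3; apply; rewrite subr_gt0.
(* Each index concerned belongs to a time [r] in [[s, t]], where the bound along [xi] holds. *)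
have HB' j : (grid_index (h k) s < j <= grid_index (h k) t)%N ->
    B' <= lambda / 2 * sqdist (u k j) y.
  move=> /(grid_index_onto _ _ _ _ (h_gt0 k) s0 st)[r /andP[sr rt] <-].
  have r0 := le_trans s0 sr.
  have [_ _ _ _ /(_ r)] := hu k.
  rewrite r0 (le_trans rt tk) => /(_ isT) /ltW vr.
  have := sqdist_close _ _ _ _ _ vr (xiD r _); rewrite r0 rt => /(_ isT) close.
  have := HB r; rewrite sr rt => /(_ isT) Br.
  have : `|lambda / 2 * (sqdist (v k r) y - sqdist (xi r) y)| <= B - B'.
    apply: le_trans ksmall; rewrite normrM normrM (ger0_norm (_ : 0 <= 2^-1))//.
    by rewrite ler_wpM2l// divr_ge0.
  rewrite ler_norml => /andP[+ _]; rewrite mulrBr; lra.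
have := discrete_evi _ phi_gtNy _ _ _ Gamma_geod phi_convex d2_convex Gamma_comm
  (h_gt0 k) (u0_dom k) (u_step k) y B' _ _ dy mn HB'.
have a0 : phir (u k (grid_index (h k) s)) <= phir x0.
  have := discrete_nonincr _ phi_gtNy (h_gt0 k) (u0_dom k) (u_step k) 0%N
    (grid_index (h k) s) (leq0n _).
  by rewrite u0.
move=> evi; apply: le_trans (le_trans evi _).
  rewrite lerD2l ler_wpM2l//; first by rewrite mulr_ge0// ltW.
  by rewrite lerD2r lerD2l.
by rewrite ler_wpM2l ?lerB// mulr_ge0 ?divr_ge0// ltW.
Unshelve. all: by end_near. Qed.

(** [xi_evi] tested with [y := xi s]. By [xi_holder] the lambda-term is at least [- (C * (t - s))];
    the gain over [xi_holder] is that the energy at [s] replaces the initial one. *)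
Lemma xi_slope (T : R) : exists2 C : R, 0 <= C & forall s t,
  0 <= s -> s <= t -> t <= T ->
  sqdist (xi s) (xi t) <=
    2 * (t - s) * (phir (xi s) - phir (xi t) + C * (t - s)).
Proof.
have [m xim] := phi_xi_bounded T.
pose C := `|lambda| * `|phir x0 - m|.
exists C; first by rewrite mulr_ge0.
move=> s t s0 st tT; have t0 := le_trans s0 st.
have [->|s_neq_t] := eqVneq s t; first by rewrite sqdistxx !subrr mulr0 mul0r.
have HB r : s <= r <= t -> - (C * (t - s)) <= lambda / 2 * sqdist (xi r) (xi s).
  move=> /andP[sr rt]; have r0 := le_trans s0 sr.
  have d2 : sqdist (xi r) (xi s) <= 2 * (t - s) * `|phir x0 - m|.
    rewrite sqdist_sym; apply: le_trans (xi_holder s r s0 sr) _.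
    apply: (@le_trans _ _ (2 * (r - s) * `|phir x0 - m|)).
      rewrite ler_wpM2l ?mulr_ge0 ?subr_ge0//; apply: le_trans (ler_norm _).
      by rewrite lerD2l lerN2 xim// r0 (le_trans rt).
    by rewrite ler_wpM2r// ler_pM2l// lerD2r.
  rewrite lerNl -mulNr -mulNr.
  apply: (@le_trans _ _ (`|lambda| / 2 * sqdist (xi r) (xi s))).
    by rewrite ler_wpM2r ?sqdist_ge0// ler_wpM2r// lerNl lerNnormlW.
  apply: le_trans (ler_wpM2l _ d2) _; first by rewrite divr_ge0.
  by rewrite /C le_eqVlt; apply/orP; left; apply/eqP; field.
have := xi_evi s t (xi s) _ s0 st (xi_dom s s0) HB.
by rewrite sqdistxx (sqdist_sym (xi t)) /=; lra.
Qed.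

Lemma xi_right_continuous (s e : R) : 0 <= s -> 0 < e ->
  exists2 d : R, 0 < d & forall t, s <= t < s + d -> mdist (xi t) (xi s) < e.
Proof.
move=> s0 e0; have [m xim] := phi_xi_bounded (s + 1).
pose C := `|phir x0 - m| + 1.
have C0 : 0 < C by rewrite ltr_wpDl.
have d0 : 0 < e ^+ 2 / (2 * C) by rewrite divr_gt0 ?exprn_gt0// mulr_gt0.
(* Within time 1 the bound [m] applies, so [C] dominates the energy drop and [xi_holder] gives d^2 <
   e^2. *)
exists (Num.min 1 (e ^+ 2 / (2 * C))); first by rewrite lt_min ltr01.
move=> t /andP[st]; rewrite -ltrBlDl lt_min => /andP[t1 td].
have t0 := le_trans s0 st.
rewrite -(@ltr_pXn2r _ 2) ?nnegrE ?mdist_ge0 ?ltW//.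
rewrite -[ltLHS]/(sqdist (xi t) (xi s)) sqdist_sym.
apply: le_lt_trans (xi_holder s t s0 st) _.
move: td; rewrite ltr_pdivlMr ?mulr_gt0//; apply: le_lt_trans.
rewrite mulrCA mulrA ler_wpM2l ?mulr_ge0 ?subr_ge0//.
apply: (@le_trans _ _ (phir x0 - m)).
  by rewrite lerD2l lerN2 xim// t0/= ltW// addrC -ltrBlDr.
by apply: le_trans (ler_norm _) _; rewrite lerDl.
Qed.

Lemma phi_xi_lsc_right (s A : R) : 0 <= s -> A < phir (xi s) ->
  exists2 d : R, 0 < d & forall t, s <= t < s + d -> A < phir (xi t).
Proof.
move=> s0 As; have [e e0 He] := lsc_fine (xi s) A (xi_dom s s0) As.
have [d d0 Hd] := xi_right_continuous s e s0 e0.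
exists d => // t tsd; apply: He; first exact: Hd.
by apply: xi_dom; apply: le_trans s0 _; case/andP: tsd.
Qed.

(** [xi_evi] on [[t, t + r]]: half of [e] pays for freezing the lambda-term at [t], the other half
    for replacing [phi (xi (t + r))] by [phi (xi t)]. *)
Lemma xi_evi_local (t : R) (y : X) (e : R) : 0 <= t -> dom y -> 0 < e ->
  exists2 d : R, 0 < d & forall r, 0 < r < d ->
    (sqdist (xi (t + r)) y - sqdist (xi t) y) / (2 * r) +
      lambda / 2 * sqdist (xi t) y + phir (xi t) <= phir y + e.
Proof.
move=> t0 dy e0; pose D := mdist (xi t) y.
have D0 : 0 <= D := mdist_ge0 _ _.
(* By [sqdist_close], a displacement below 1 changes the lambda-term by at most [q] times itself;
   the added 1 keeps [q] positive. *)
pose q := `|lambda| / 2 * (2 * D + 1) + 1.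
have q0 : 0 < q.
  by rewrite ltr_wpDl// mulr_ge0 ?divr_ge0// addr_ge0// mulr_ge0.
have [|d1 d10 H1] := xi_right_continuous t (Num.min 1 (e / 2 / q)) t0.
  by rewrite lt_min ltr01/= !divr_gt0.
have [|d2 d20 H2] := phi_xi_lsc_right t (phir (xi t) - e / 2) t0.
  by rewrite ltrBlDr ltrDl divr_gt0.
exists (Num.min d1 d2); first by rewrite lt_min d10.
move=> r /andP[r0]; rewrite lt_min => /andP[rd1 rd2].
have ttr : t <= t + r by rewrite lerDl ltW.
have HB w : t <= w <= t + r ->
    lambda / 2 * sqdist (xi t) y - e / 2 <= lambda / 2 * sqdist (xi w) y.
  move=> /andP[tw wtr].
  have wd1 : t <= w < t + d1 by rewrite tw (le_lt_trans wtr)// ltrD2l.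
  have := H1 w wd1; rewrite lt_min => /andP[w1 wq].
  have close := sqdist_close _ _ _ _ _ (lexx (mdist (xi w) (xi t))) (lexx D).
  have : `|lambda / 2 * (sqdist (xi w) y - sqdist (xi t) y)| <= e / 2.
    rewrite normrM normrM (ger0_norm (_ : 0 <= 2^-1))//.
    apply: le_trans (ler_wpM2l _ close) _; first by rewrite divr_ge0.
    move: wq; rewrite ltr_pdivlMr// => /ltW; apply: le_trans.
    rewrite mulrCA ler_wpM2l ?mdist_ge0//.
    rewrite -[leLHS]addr0 lerD// ler_wpM2l ?divr_ge0//.
    by rewrite lerD2l ltW.
  by rewrite ler_norml => /andP[+ _]; rewrite mulrBr; lra.
have := xi_evi t (t + r) y _ t0 ttr dy HB.
rewrite [t + r - t]addrAC subrr add0r.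
have /H2 : t <= t + r < t + d2 by rewrite ttr/= ltrD2l.
move=> /ltW phitr evi.
have : (sqdist (xi (t + r)) y - sqdist (xi t) y) / 2 <=
    r * (phir y - (lambda / 2 * sqdist (xi t) y - e / 2) -
      (phir (xi t) - e / 2)).
  have : r * (phir (xi t) - e / 2) <= r * phir (xi (t + r)).
    by rewrite ler_pM2l.
  by move: evi; rewrite /=; lra.
rewrite [r * _]mulrC -ler_pdivrMr// => H; rewrite invfM mulrA; lra.
Qed.

Lemma sqdist_xi_ae_derivable (T : R) (y : X) : dom y ->
  {ae (@lebesgue_measure R), forall t, 0 < t < T ->
     derivable (fun s : R => sqdist (xi s) y) t 1}.
Proof.
move=> dy; have [m xim] := phi_xi_bounded T.
have [D xiD] := xi_bounded T y.
have [C C0 slope] := xi_slope T.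
(* By [xi_evi], [2 * L] bounds the growth rate of the squared distance on [[0, T]], so [F] is
   nondecreasing. *)
pose L := `|phir y - m + `|lambda| / 2 * D ^+ 2|.
pose F t := 2 * L * t - sqdist (xi t) y.
pose P t := C * t - phir (xi t).
have FdP s t : 0 <= s -> s <= t -> t <= T ->
    sqdist (xi t) y - sqdist (xi s) y <= 2 * L * (t - s).
  move=> s0 st tT; have t0 := le_trans s0 st.
  have HB r : s <= r <= t ->
      - (`|lambda| / 2 * D ^+ 2) <= lambda / 2 * sqdist (xi r) y.
    move=> /andP[sr rt]; have r0 := le_trans s0 sr.
    have rD : mdist (xi r) y <= D by rewrite xiD// r0 (le_trans rt).
    rewrite lerNl -mulNr -mulNr.
    apply: (@le_trans _ _ (`|lambda| / 2 * sqdist (xi r) y)).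
      by rewrite ler_wpM2r ?sqdist_ge0// ler_wpM2r// lerNl lerNnormlW.
    rewrite ler_wpM2l ?divr_ge0// lerXn2r// ?nnegrE ?mdist_ge0//.
    exact: le_trans (mdist_ge0 _ _) rD.
  have : (t - s) * (phir y - phir (xi t) + `|lambda| / 2 * D ^+ 2) <=
      (t - s) * L.
    rewrite ler_wpM2l ?subr_ge0//; apply: le_trans (ler_norm _).
    by rewrite lerD2r lerD2l lerN2 xim// t0.
  by have := xi_evi s t y _ s0 st dy HB; rewrite /=; lra.
have inT s : s \in `[0, T] -> 0 <= s <= T by rewrite in_itv.
have F_nd : {in `[0, T] &, {homo F : s t / s <= t}}.
  move=> s t /inT/andP[s0 _] /inT/andP[_ tT] st.
  by have := FdP s t s0 st tT; rewrite /F; lra.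
have P_ge s t : 0 <= s -> s <= t -> t <= T ->
    sqdist (xi s) (xi t) <= 2 * ((t - s) * (P t - P s)).
  move=> s0 st tT; apply: le_trans (slope s t s0 st tT) _.
  by rewrite /P /= le_eqVlt; apply/orP; left; apply/eqP; ring.
have P_nd : {in `[0, T] &, {homo P : s t / s <= t}}.
  move=> s t /inT/andP[s0 _] /inT/andP[_ tT].
  rewrite le_eqVlt => /predU1P[->//|st].
  have := le_trans (sqdist_ge0 _ _) (P_ge s t s0 (ltW st) tT).
  by rewrite !pmulr_rge0 ?subr_gt0// subr_ge0.
suff : {ae (@lebesgue_measure R), forall t, 0 < t < T -> derivable F t 1}.
  apply: filterS; first exact: (ae_filter_ringOfSetsType (@lebesgue_measure R)).
  move=> t Ft t0T; have {}Ft := Ft t0T.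
  have -> : (fun s => sqdist (xi s) y) = (fun s => 2 * L * s) - F.
    by apply/funext => s; rewrite /F !fctE opprB addrC subrK.
  exact: derivableB.
apply: (@ae_derivable_itv _ F P) => //.
  (* Right continuity of [P] asks only for an upper bound, given by lower semicontinuity of [phi]
     along [xi] from the right. *)
  move=> s e /inT/andP[s0 _] e0.
  have [|d1 d10 H1] := phi_xi_lsc_right s (phir (xi s) - e / 2) s0.
    by rewrite ltrBlDr ltrDl divr_gt0.
  have d20 : 0 < e / 2 / (C + 1) by rewrite !divr_gt0// ltr_wpDl.
  exists (Num.min d1 (e / 2 / (C + 1))); first by rewrite lt_min d10.
  move=> t _ /andP[st]; rewrite -ltrBlDl lt_min => /andP[td1 td2].
  have /H1 : s <= t < s + d1 by rewrite st -ltrBlDl.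
  move: td2; rewrite ltr_pdivlMr; last exact: ltr_wpDl.
  by rewrite mulrDr mulr1; move: st; rewrite /P /=; lra.
(* [4 * D1] is a Lipschitz constant of d^2(., y) along the bounded curve; the AM-GM weight [q] makes
   the coefficient of [P t - P s] equal to [e]. *)
move=> e e0; pose D1 := `|D| + 1.
have D10 : 0 < D1 by rewrite ltr_wpDl.
pose q := e / (4 * D1).
have q0 : 0 < q by rewrite divr_gt0// mulr_gt0.
exists (2 * L + 4 * D1 / q).
  apply: addr_ge0; first by rewrite /L mulr_ge0.
  by rewrite divr_ge0 ?(ltW q0)// mulr_ge0 ?(ltW D10).
move=> s t /inT/andP[s0 sT] /inT/andP[t0 tT] st.
have Pst : 0 <= P t - P s by rewrite subr_ge0 P_nd// in_itv/= ?s0 ?t0.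
(* For nonnegative A and B, d^2 <= 2 A B implies d <= A + B. *)
have dst : mdist (xi s) (xi t) <= (t - s) / q + q * (P t - P s).
  have X0 : 0 <= (t - s) / q by rewrite divr_ge0 ?subr_ge0// ltW.
  have Y0 : 0 <= q * (P t - P s) by rewrite mulr_ge0// ltW.
  rewrite -(@ler_pXn2r _ 2) ?nnegrE ?mdist_ge0 ?addr_ge0//.
  apply: le_trans (P_ge s t s0 st tT) _.
  have -> : (t - s) * (P t - P s) = ((t - s) / q) * (q * (P t - P s)).
    by rewrite -mulrA mulKf ?gt_eqF.
  move: ((t - s) / q) (q * _) X0 Y0 => A B _ _.
  by have := sqr_ge0 A; have := sqr_ge0 B; lra.
have fst : sqdist (xi s) y - sqdist (xi t) y <= 4 * D1 * mdist (xi s) (xi t).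
  have sD := xiD s; rewrite s0 sT in sD; have {}sD := sD isT.
  have tD := xiD t; rewrite t0 tT in tD; have {}tD := tD isT.
  have := sqdist_close _ _ _ _ _ (lexx (mdist (xi s) (xi t))) tD.
  move=> /(le_trans (ler_norm _))/le_trans; apply.
  rewrite mulrC ler_wpM2r ?mdist_ge0//.
  have := metric_triangle (xi s) y (xi t); rewrite (metric_sym y).
  by have := ler_norm D; rewrite /D1; lra.
have : 4 * D1 * mdist (xi s) (xi t) <=
    4 * D1 / q * (t - s) + e * (P t - P s).
  apply: le_trans (ler_wpM2l _ dst) _; first by rewrite mulr_ge0// ltW.
  rewrite mulrDr mulrA lerD//; last first.
    rewrite mulrA /q mulrCA divff ?mulr1//.
    by rewrite mulf_neq0// gt_eqF.
  by rewrite mulrAC.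
by rewrite /F; lra.
Qed.

End limit_curve.

(** * From difference quotients to the upper right derivative and the derivative *)

Lemma limf_esup_at_right_le (R : realType) (f : R -> \bar R) (c : \bar R)
    (d : R) :
  0 < d -> (forall r, 0 < r < d -> (f r <= c)%E) -> (limf_esup f 0^'+ <= c)%E.
Proof.
move=> d0 fc; apply: le_trans (ereal_inf_lbound _) _.
  exists [set r | 0 < r < d] => //.
  near=> r; apply/andP; split; near: r.
    exact: nbhs_right_gt.
  exact: nbhs_right_lt.
by apply: ge_ereal_sup => _ [r /= rd <-]; exact: fc.
Unshelve. all: by end_near. Qed.

Lemma derive1_le_right (R : realType) (f : R -> R) (t c d : R) :
  derivable f t 1 -> 0 < d ->
  (forall r, 0 < r < d -> (f (t + r) - f t) / r <= c) -> derive1 f t <= c.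
Proof.
move=> ft d0 fc; rewrite derive1E.
have /cvg_dnbhs_at_right fr : h^-1 *: ((f \o shift t) (h *: 1) - f t)
   @[h --> 0^'] --> 'D_1 f t by exact: ft.
apply: (cvgr_to_le fr); near=> r => /=.
rewrite [r%:A]mulr1 (addrC r t) [_ *: _]mulrC; apply: fc.
apply/andP; split; near: r.
  exact: nbhs_right_gt.
exact: nbhs_right_lt.
Unshelve. all: by end_near. Qed.

Theorem theorem4p8 (R : realType) (X : completeMetricType R)
    (phi : X -> \bar R) (Gamma : set (R -> X)) (lambda K : R)
    (tau_star : \bar R) (G : R -> X -> X) (x0 : X)
    (phi_gtNy : forall x, (-oo < phi x)%E)
    (phi_lsc : lower_semicontinuous phi)
    (phi_proper : effective_domain phi !=set0)
    (Gamma_geod : geodesic_family Gamma)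
    (phi_convex : convex_along Gamma lambda phi)
    (d2_convex : sqdist_convex_along Gamma K)
    (Gamma_comm : commutativity Gamma)
    (phi_coercive : coercive phi tau_star)
    (G_flow : gradient_flow_operator phi tau_star G)
    (x0_dom : effective_domain phi x0) :
  let xi := fun t : R => G t x0 in
  (forall y, effective_domain phi y -> forall t : R, 0 < t ->
     (limf_esup
        (fun e : R =>
           ((sqdist (xi (t + e)) y - sqdist (xi t) y) / (2 * e))%:E) 0^'+
      + (lambda / 2 * sqdist (xi t) y)%:E + phi (xi t) <= phi y)%E) /\
  (forall y, effective_domain phi y ->
     {ae lebesgue_measure, forall t : R, 0 < t ->
        derivable (fun s : R => sqdist (xi s) y) t 1 /\
        ((2^-1 * derive1 (fun s : R => sqdist (xi s) y) t
          + lambda / 2 * sqdist (xi t) y)%:E + phi (xi t) <= phi y)%E}).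
Proof.
move=> xi; have [_ xi_dom xi_cvg] := G_flow x0 x0_dom.
have [h [u hu]] := grid_approx_ex phi_coercive xi_cvg.
have evi := xi_evi_local phi_gtNy phi_lsc Gamma_geod phi_convex d2_convex
  Gamma_comm phi_coercive x0_dom xi_dom hu.
split=> [y dy t t0|y dy].
  (* The inequality solved for the upper derivative, as a real number. *)
  pose c := fine (phi y) - lambda / 2 * sqdist (xi t) y - fine (phi (xi t)).
  suff H : (limf_esup (fun e : R =>
      ((sqdist (xi (t + e)) y - sqdist (xi t) y) / (2 * e))%:E) 0^'+ <= c%:E)%E.
    rewrite -(effective_domain_fine _ phi_gtNy (xi t) (xi_dom t (ltW t0))).
    rewrite -(effective_domain_fine _ phi_gtNy y dy) -addeA -EFinD.
    rewrite -leeBrDr// -EFinB; apply: le_trans H _.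
    by rewrite lee_fin /c /=; lra.
  apply/lee_addgt0Pr => e e0; rewrite -EFinD.
  have [d d0 Hd] := evi t y e (ltW t0) dy e0.
  apply: (limf_esup_at_right_le _ _ _ d d0) => r rd; rewrite lee_fin /c.
  by have := Hd r rd; rewrite /=; lra.
(* One null set for each interval []0, n[]; their countable union is null. *)
have aed (n : nat) := sqdist_xi_ae_derivable phi_gtNy phi_lsc Gamma_geod
  phi_convex d2_convex Gamma_comm phi_coercive x0_dom xi_dom hu n%:R y dy.
have := ae_foralln aed; apply: filterS => t Ht t0.
have ft : derivable (fun s : R => sqdist (xi s) y) t 1.
  by apply: (Ht (Num.bound t)); rewrite t0 archi_boundP// ltW.
split=> //.
rewrite -(effective_domain_fine _ phi_gtNy (xi t) (xi_dom t (ltW t0))).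
rewrite -(effective_domain_fine _ phi_gtNy y dy) -EFinD lee_fin.
apply/ler_addgt0Pr => e e0.
have [d d0 Hd] := evi t y e (ltW t0) dy e0.
(* The derivative is also the limit of right quotients, to which the local estimate applies; the
   factor 2 comes from the denominator [2 * r]. *)
suff : derive1 (fun s : R => sqdist (xi s) y) t <=
    2 * (fine (phi y) + e - lambda / 2 * sqdist (xi t) y - fine (phi (xi t))).
  by rewrite /=; lra.
apply: (derive1_le_right _ _ t _ d ft d0) => r rd.
by have := Hd r rd; rewrite invfM [in X in X -> _]mulrA /=; lra.
Qed.
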